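(* Fix $\epsilon>0$, $\delta\in(0,\tfrac1e)$ and $B>0$. Fix a positive integer $r$ and let $w$ be such that \[ w^2=B^2\left(1+\frac{1+\frac{\epsilon}{\ln(4/\delta)}}{\epsilon}\left(2\sqrt{2r\ln(\tfrac4\delta)}+2\ln(\tfrac4\delta)\right)\right). \] Let $A$ be an $(n\times d)$-matrix with $d<r$ in which every row has $\ell_2$-norm at most $B$. Given that $\sigma_{\min}(A)\ge w$, the algorithm that picks an $(r\times n)$-matrix $R$ whose entries are i.i.d. samples from $\mathcal N(0,1)$ and publishes $R\cdot A$ is $(\epsilon,\delta)$-differentially private.
   Context: $\sigma_{\min}(A)$ is the least singular value of $A$. Two $(n\times d)$-matrices are neighbors if they differ in exactly one row. A randomized algorithm defined on a class of inputs (here: $(n\times d)$-matrices with rows of $\ell_2$-norm at most $B$ and $\sigma_{\min}(A)\ge w$) is $(\epsilon,\delta)$-differentially private if for all neighboring inputs $A,A'$ in the class and every measurable set $S$ of outputs, $\Pr[\mathsf{ALG}(A)\in S]\le e^{\epsilon}\Pr[\mathsf{ALG}(A')\in S]+\delta$. *)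

(* Defs.v *)
From HB Require Import structures.
From mathcomp Require Import all_boot all_order all_algebra.
From mathcomp Require Import all_classical all_reals all_analysis.
Set Implicit Arguments. Unset Strict Implicit. Unset Printing Implicit Defensive.
Import Order.TTheory GRing.Theory Num.Theory.
Local Open Scope classical_set_scope.
Local Open Scope ring_scope.

Section Defs.
Context {R : realType}.

Definition rnorm (k : nat) (v : 'rV[R]_k) : R := Num.sqrt (\sum_j v 0 j ^+ 2).
Definition cnorm (k : nat) (v : 'cV[R]_k) : R := Num.sqrt (\sum_i v i 0 ^+ 2).

Definition rows_bounded (n d : nat) (B : R) (A : 'M[R]_(n, d)) : Prop :=
  forall i : 'I_n, rnorm (row i A) <= B.

(* Least singular value of A : 'M_(n,d), as min_{||x||=1} ||A x||
   (variational definition; equals sqrt of the least eigenvalue of A^T A). *)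
Definition sigma_min (n d : nat) (A : 'M[R]_(n, d)) : R :=
  inf [set cnorm (A *m x) | x in [set x : 'cV[R]_d | cnorm x = 1]].

Definition neighbors (n d : nat) (A A' : 'M[R]_(n, d)) : Prop :=
  exists i : 'I_n, row i A != row i A' /\
    (forall k : 'I_n, k != i -> row k A = row k A').

(* Borel sigma-algebra on 'M_(m,k): generated by the coordinate maps. *)
Definition mx_measurable (m k : nat) (S : set 'M[R]_(m, k)) : Prop :=
  <<s [set T | exists (i : 'I_m) (j : 'I_k) (E : set R),
                 measurable E /\ T = (fun M : 'M[R]_(m, k) => M i j) @^-1` E] >> S.

Definition iid_std_gaussian_mx (dO : measure_display) (Omega : measurableType dO)
    (P : probability Omega R) (r n : nat) (G : 'I_r -> 'I_n -> Omega -> R) : Prop :=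
  (forall i j, measurable_fun setT (G i j)) /\
  (forall i j (E : set R), measurable E ->
      P (G i j @^-1` E) = normal_prob 0 1 E) /\
  (forall E : 'I_r -> 'I_n -> set R, (forall i j, measurable (E i j)) ->
      P (\bigcap_(k in [set: 'I_r * 'I_n]) (G k.1 k.2 @^-1` E k.1 k.2)) =
      (\prod_(k : 'I_r * 'I_n) P (G k.1 k.2 @^-1` E k.1 k.2))%E).

Definition rand_mx (dO : measure_display) (Omega : measurableType dO)
    (r n : nat) (G : 'I_r -> 'I_n -> Omega -> R) (omega : Omega) : 'M[R]_(r, n) :=
  \matrix_(i, j) G i j omega.

Definition gaussian_projection_dp (dO : measure_display) (Omega : measurableType dO)
    (P : probability Omega R) (r n d : nat) (G : 'I_r -> 'I_n -> Omega -> R)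
    (B w eps delta : R) : Prop :=
  forall A A' : 'M[R]_(n, d),
    rows_bounded B A -> w <= sigma_min A ->
    rows_bounded B A' -> w <= sigma_min A' ->
    neighbors A A' ->
    forall S : set 'M[R]_(r, d), mx_measurable S ->
      (P [set omega | rand_mx G omega *m A \in S]
       <= (expR eps)%:E * P [set omega | rand_mx G omega *m A' \in S] + delta%:E)%E.

End Defs.

(* Main.v *)
Require Import Defs.
From HB Require Import structures.
From mathcomp Require Import all_boot all_order all_algebra ring lra.
From mathcomp Require Import all_classical all_reals all_analysis.
From mathcomp Require Import measurable_realfun.
Set Implicit Arguments. Unset Strict Implicit. Unset Printing Implicit Defensive.
Import Order.TTheory GRing.Theory Num.Theory.
Import numFieldNormedType.Exports.
Local Open Scope classical_set_scope.
Local Open Scope ring_scope.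

(** Let [A0] be [A] with the differing row [i] erased. Row [i] of [A] equals [z^T A0]
    with [z i = 0], and the bounds on [A] give [|z|^2 <= B^2 / (w^2 - B^2)]. Hence
    [R A = (R + R_i z^T) A0], where [R_i] is column [i] of [R], which [R A0] ignores.
    Shifting coordinate by coordinate (Cameron-Martin) and integrating [R_i] out, the
    law of [R + R_i z^T] has density
    [(1 + |z|^2)^(-r/2) exp (|R z|^2 / (2 (1 + |z|^2)))] relative to that of [R], and
    the exponential moments of [|R z|^2] are explicit. Markov's inequality for powers of
    this density compares [A] with [A0] (privacy loss [5/8 eps]), and [A0] with [A']
    (privacy loss [3/8 eps]); each step costs a probability of at most [delta / 4]. *)

(** * Integration against one-dimensional normal laws *)

Section normal_integral.
Local Open Scope ereal_scope.
Context {R : realType}.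
Local Notation mu := (@lebesgue_measure R).

(** The Radon-Nikodym derivative of the normal law and [normal_pdf] have the same integral over
    every measurable set, so they agree almost everywhere. *)
Lemma ge0_integral_normal_prob (m s : R) (f : R -> \bar R) :
  (forall x, 0 <= f x) -> measurable_fun [set: R] f ->
  \int[normal_prob m s]_x f x = \int[mu]_x (f x * (normal_pdf m s x)%:E).
Proof.
move=> f0 mf.
have dom := @normal_prob_dominates R m s.
rewrite -(Radon_Nikodym_SigmaFinite.change_of_variables dom f0 measurableT mf).
have iRN := Radon_Nikodym_SigmaFinite.f_integrable dom.
apply: ae_eq_integral => //.
- by apply: emeasurable_funM => //; exact: measurable_int iRN.
- apply: emeasurable_funM => //; apply/measurable_EFinP.
  exact: measurable_normal_pdf.
- apply: ae_eqe_mul2l; apply: integral_ae_eq => //.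
  + by apply/measurable_EFinP; exact: measurable_normal_pdf.
  + by move=> A _ mA; rewrite -Radon_Nikodym_SigmaFinite.f_integral.
Qed.

(** Uniqueness of Lebesgue measure: the translated measure gives each half-open interval its
    length. *)
Lemma ge0_integral_lebesgue_shift (c : R) (f : R -> \bar R) :
  (forall x, 0 <= f x) -> measurable_fun [set: R] f ->
  \int[mu]_x f (x + c)%R = \int[mu]_x f x.
Proof.
move=> f0 mf.
have mc : measurable_fun setT ((fun x => x + c)%R : measurableTypeR R -> measurableTypeR R).
  exact: measurable_funD.
rewrite -[LHS](@ge0_integral_pushforward _ _ _ _ R _ mc mu setT f)//.
apply: eq_measure_integral => A mA _.
apply/esym; apply: (lebesgue_measure_unique (mu := pushforward mu
  (fun x : measurableTypeR R => x + c : measurableTypeR R)%R)) => //.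
move=> _ [[a b]] _ <-; rewrite /= /pushforward.
rewrite (_ : _ @^-1` _ = `](a - c)%R, (b - c)%R]%classic); last first.
  by apply/seteqP; split => x /=; rewrite !in_itv/= ltrBlDr lerBrDr.
by rewrite !lebesgue_measure_itv/= !lte_fin ltrD2r -!EFinB opprB addrA subrK.
Qed.

(** One-dimensional Cameron-Martin: the weight is the ratio at [x] of the normal densities with
    means [c] and 0. *)
Lemma ge0_integral_normal_shift (c : R) (f : R -> R) :
  (forall x, (0 <= f x)%R) -> measurable_fun [set: R] f ->
  \int[normal_prob 0 1]_x (f (x + c))%:E =
  \int[normal_prob 0 1]_x (f x * expR (c * x - c ^+ 2 / 2))%:E.
Proof.
move=> f0 mf.
have mexp : measurable_fun [set: R] (fun x => expR (c * x - c ^+ 2 / 2))%R.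
  by apply: measurableT_comp => //; exact: measurable_funB.
rewrite !ge0_integral_normal_prob//; first last.
- apply/measurable_EFinP; apply: measurableT_comp => //; exact: measurable_funD.
- by move=> x; rewrite lee_fin.
- by apply/measurable_EFinP; apply: measurable_funM.
- by move=> x; rewrite lee_fin mulr_ge0 ?expR_ge0.
rewrite -[RHS](ge0_integral_lebesgue_shift c).
- apply: eq_integral => x _; rewrite -!EFinM -mulrA; congr ((_ * _)%:E).
  rewrite !normal_pdfE ?oner_neq0// mulrCA; congr (_ * _)%R.
  rewrite /normal_fun -expRD; congr expR.
  by rewrite !subr0 expr1n; field.
- by move=> x; rewrite -EFinM lee_fin !mulr_ge0 ?expR_ge0// normal_pdf_ge0.
- under eq_fun do rewrite -EFinM.
  apply/measurable_EFinP; apply: measurable_funM; first exact: measurable_funM.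
  exact: measurable_normal_pdf.
Qed.

(** Completing the square: the integrand times the standard density is a constant multiple of the
    normal density with mean [a / (1 + b)] and variance [(1 + b)^-1]. *)
Lemma integral_normal_expR_sqrt (a b : R) : (-1 < b)%R ->
  \int[normal_prob 0 1]_x (expR (a * x - b / 2 * x ^+ 2))%:E =
  ((Num.sqrt (1 + b))^-1 * expR (a ^+ 2 / (2 * (1 + b))))%:E.
Proof.
move=> b1.
have b0 : (0 < 1 + b)%R by rewrite -ltrBlDl sub0r.
have mexp : measurable_fun [set: R] (fun x => expR (a * x - b / 2 * x ^+ 2))%R.
  apply: measurableT_comp => //; apply: measurable_funB => //.
  by apply: measurable_funM => //; exact: measurable_funX.
set s := (Num.sqrt (1 + b))^-1%R.
have s0 : (0 < s)%R by rewrite invr_gt0 sqrtr_gt0.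
have s2 : (s ^+ 2 = (1 + b)^-1)%R by rewrite exprVn sqr_sqrtr// ltW.
rewrite ge0_integral_normal_prob//; last exact/measurable_EFinP.
transitivity (\int[mu]_x ((s * expR (a ^+ 2 / (2 * (1 + b))))%:E * (normal_pdf (a / (1 + b)) s x)%:E)).
  apply: eq_integral => x _; rewrite -!EFinM; congr EFin.
  rewrite !normal_pdfE ?oner_neq0 ?gt_eqF//.
  have -> : (normal_peak 1 = s * normal_peak s :> R)%R.
    rewrite /normal_peak expr1n mul1r -mulrnAr sqrtrM ?sqr_ge0// sqrtr_sqr gtr0_norm//.
    by rewrite invfM mulrA divff ?gt_eqF// mul1r.
  rewrite mulrCA [RHS]mulrACA; congr (_ * _)%R.
  rewrite /normal_fun -!expRD; congr expR.
  by rewrite s2 expr1n subr0; field; rewrite gt_eqF.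
rewrite ge0_integralZl//; last 3 first.
- by apply/measurable_EFinP; exact: measurable_normal_pdf.
- by move=> x _; rewrite lee_fin normal_pdf_ge0.
- by rewrite lee_fin mulr_ge0 ?expR_ge0 ?ltW.
by rewrite integral_normal_pdf mule1.
Qed.

End normal_integral.

(** * Finite powers of the real line with the product sigma-algebra *)

Section function_space.
Context {R : realType} {I : finType}.

Definition boxes : set (set (I -> R)) :=
  [set C | exists2 E : I -> set R, (forall i, measurable (E i)) &
           C = [set x | forall i, E i (x i)]].

(** Boxes generate the product sigma-algebra and are closed under intersection ([boxesI]), so two
    laws on [fspace] need only be compared on boxes. *)
Definition fspace : Type := g_sigma_algebraType boxes.
HB.instance Definition _ := Measurable.on fspace.

Lemma boxesI : setI_closed boxes.
Proof.
move=> _ _ [E mE ->] [E' mE' ->]; exists (fun i => E i `&` E' i).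
  by move=> i; apply: (@measurableI _ R) => //.
apply/seteqP; split => x /=; first by move=> [h1 h2] i.
by move=> h; split => i; have [] := h i.
Qed.

Definition upd (x : fspace) (p : I) (y : R) : fspace :=
  fun q => if q == p then y else x q.

Lemma measurable_coord (i : I) : measurable_fun [set: fspace] (fun x => x i).
Proof.
move=> _ Y mY; rewrite setTI; apply: sub_sigma_algebra.
exists (fun j => if j == i then Y else setT); first by move=> j; case: ifP.
apply/seteqP; split => x /= h; first by move=> j; case: eqP => // ->.
by have := h i; rewrite eqxx.
Qed.

Lemma measurable_fspace d (T : measurableType d) (f : T -> fspace) :
  (forall i, measurable_fun [set: T] (fun t => f t i)) ->
  measurable_fun [set: T] f.
Proof.
move=> mf; apply: (@measurability _ _ T fspace setT f boxes) => // _ [_ [E mE ->] <-].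
rewrite (_ : _ `&` _ = \bigcap_(i in [set: I]) ((fun t => f t i) @^-1` E i)).
  apply: fin_bigcap_measurable => // i _.
  by rewrite -[X in measurable X]setTI; exact: mf.
by apply/seteqP; split => t /=; [move=> [_ h] i _; exact: h|move=> h; split=> // i; exact: h].
Qed.

Lemma measurable_upd (p : I) :
  measurable_fun [set: fspace * R] (fun xy => upd xy.1 p xy.2).
Proof.
apply: measurable_fspace => i; rewrite /upd; have [_|_] := eqVneq i p => //.
  exact: measurable_snd.
exact: (measurableT_comp (measurable_coord i) measurable_fst).
Qed.

End function_space.
Arguments fspace : clear implicits.

(** * Redrawing one coordinate of a Gaussian vector *)

Section resampling.
Local Open Scope ereal_scope.
Context d (Omega : measurableType d) {R : realType} (P : probability Omega R).
Context {I : finType} (X : Omega -> fspace R I).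
Hypothesis mX : measurable_fun [set: Omega] X.
Hypothesis PX : forall E : I -> set R, (forall i, measurable (E i)) ->
  P [set w | forall i, E i (X w i)] = \prod_i normal_prob 0 1 (E i).

(** Box probabilities are products over the coordinates, so redrawing coordinate [p] independently
    does not change them. Boxes determine the law, and Tonelli then isolates the integral over the
    new draw. *)
Lemma integral_resample (p : I) (F : fspace R I -> R) :
  (forall x, (0 <= F x)%R) -> measurable_fun [set: fspace R I] F ->
  \int[P]_w (F (X w))%:E =
  \int[P]_w \int[normal_prob 0 1]_y (F (upd (X w) p y))%:E.
Proof.
move=> F0 mF.
pose Y (wy : Omega * measurableTypeR R) : fspace R I := upd (X wy.1) p wy.2.
have mY : measurable_fun [set: Omega * measurableTypeR R] Y.
  have mXid : measurable_fun [set: Omega * measurableTypeR R] (fun wy => (X wy.1, wy.2)).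
    by apply: measurable_fun_pair => //; exact: (measurableT_comp mX).
  exact: (measurableT_comp (measurable_upd p) mXid).
have mEF : measurable_fun [set: fspace R I] (fun x => (F x)%:E).
  exact/measurable_EFinP.
transitivity (\int[(P \x normal_prob 0 1)]_wy (F (Y wy))%:E); last first.
  rewrite fubini_tonelli1//; first exact: (measurableT_comp mEF).
  by move=> x; rewrite lee_fin.
rewrite -[LHS](@ge0_integral_pushforward _ _ _ _ R X mX P setT (fun x => (F x)%:E))//; last first.
  by move=> x _; rewrite lee_fin.
rewrite -[RHS](@ge0_integral_pushforward _ _ _ _ R Y mY (P \x normal_prob 0 1)%E
  setT (fun x => (F x)%:E))//; last first.
  by move=> x _; rewrite lee_fin.
apply: eq_measure_integral => A mA _.
have mG : @measurable _ (fspace R I) = <<s boxes >> by [].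
apply: (@measure_unique _ R (fspace R I) boxes (fun=> setT) mG boxesI _ _
  (pushforward P X) (pushforward (P \x normal_prob 0 1) Y)) => //.
- by move=> _; exists (fun=> setT) => //; apply/seteqP; split.
- by apply/seteqP; split => // x _; exists 0%N.
- move=> _ [E mE ->]; rewrite /pushforward /=.
  rewrite [LHS]PX//.
  (* The overwritten coordinate of [X] is unconstrained: side [p] of the box becomes [setT], and
     [E p] moves to the fresh draw. *)
  rewrite [X in _ = (_ \x _) X](_ : _ =
    [set w | forall i, (if i == p then setT else E i) (X w i)] `*` E p); last first.
    apply/seteqP; split => -[w y] /=; rewrite /Y /upd /=.
      move=> h; split; last by have := h p; rewrite eqxx.
      by move=> i; case: ifP => // ip; have := h i; rewrite ip.
    by move=> [h1 h2] i; have := h1 i; case: eqP => // ->.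
  have mE' i : measurable (if i == p then [set: R] else E i) by case: ifP.
  have mB : measurable
      ([set x | forall i, (if i == p then setT else E i) (x i)] : set (fspace R I)).
    by apply: sub_sigma_algebra; exists (fun i => if i == p then setT else E i).
  have mXB := mX measurableT mB; rewrite setTI in mXB.
  rewrite product_measure1E; [|exact: mXB|exact: mE].
  transitivity (P [set w | forall i, (if i == p then setT else E i) (X w i)] *
    normal_prob 0 1 (E p)); last by [].
  have /= -> := PX mE'; rewrite (bigD1 p)//= [in RHS](bigD1 p)//= eqxx.
  rewrite probability_setT mul1e muleC; congr (_ * _).
  by apply: eq_bigr => i /negbTE ->.
- by move=> _; suff : P setT < +oo by []; rewrite probability_setT ltry.
Qed.

End resampling.

(** * Nonnegative measurable functions *)

Section nonneg_measurable.
Context d (T : measurableType d) {R : realType}.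
Implicit Types f g : T -> R.

Definition nnmeas f := (forall x, 0 <= f x) /\ measurable_fun [set: T] f.

Lemma nnmeasM f g : nnmeas f -> nnmeas g -> nnmeas (fun x => f x * g x).
Proof.
move=> [f0 mf] [g0 mg]; split; first by move=> x; rewrite mulr_ge0.
exact: measurable_funM.
Qed.

Lemma nnmeasD f g : nnmeas f -> nnmeas g -> nnmeas (fun x => f x + g x).
Proof.
move=> [f0 mf] [g0 mg]; split; first by move=> x; rewrite addr_ge0.
exact: measurable_funD.
Qed.

Lemma nnmeas_cst (c : R) : 0 <= c -> nnmeas (fun=> c).
Proof. by move=> c0; split. Qed.

Lemma nnmeas_prod (K : eqType) (s : seq K) (f : K -> T -> R) :
  (forall k, k \in s -> nnmeas (f k)) -> nnmeas (fun x => \prod_(k <- s) f k x).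
Proof.
elim: s => [_|k s IH hf].
  by under eq_fun do rewrite big_nil; exact: nnmeas_cst.
under eq_fun do rewrite big_cons; apply: nnmeasM; first by apply: hf; rewrite mem_head.
by apply: IH => l ls; apply: hf; rewrite inE ls orbT.
Qed.

Lemma nnmeas_expR f : measurable_fun [set: T] f -> nnmeas (fun x => expR (f x)).
Proof.
move=> mf; split; first by move=> x; exact: expR_ge0.
exact: measurableT_comp.
Qed.

End nonneg_measurable.

(** * Functions that ignore some coordinates *)

Section coordinates.
Context {R : realType} {I : finType}.
Local Notation T := (fspace R I).

(** A pointwise form of independence from the coordinates in [D]: by [off_upd], such an [f] is
    constant in an integral over one of them. *)
Definition off (U : Type) (D : pred I) (f : T -> U) :=
  forall x x' : T, (forall q, ~~ D q -> x q = x' q) -> f x = f x'.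

Lemma off_upd (U : Type) (D : pred I) (f : T -> U) p x y :
  off D f -> D p -> f (upd x p y) = f x.
Proof.
move=> Df Dp; apply: Df => q; rewrite /upd; case: eqP => // ->.
by rewrite Dp.
Qed.

Lemma upd_eq (x : T) p y : upd x p y p = y.
Proof. by rewrite /upd eqxx. Qed.

Lemma upd_upd (x : T) p y z : upd (upd x p y) p z = upd x p z.
Proof. by apply/funext => q; rewrite /upd; case: eqP. Qed.

Lemma measurable_updf p (f : T -> R) : measurable_fun [set: T] f ->
  measurable_fun [set: T] (fun x => upd x p (f x)).
Proof.
move=> mf; apply: measurable_fspace => q; rewrite /upd.
by have [_|_] := eqVneq q p => //; exact: measurable_coord.
Qed.

End coordinates.

(** * Expectations over a standard Gaussian vector *)

Section gaussian_vector.
Context d (Omega : measurableType d) {R : realType} (P : probability Omega R).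
Context {I : finType} (X : Omega -> fspace R I).
Hypothesis mX : measurable_fun [set: Omega] X.
Hypothesis PX : forall E : I -> set R, (forall i, measurable (E i)) ->
  P [set w | forall i, E i (X w i)] = (\prod_i normal_prob 0 1 (E i))%E.
Local Notation T := (fspace R I).

Definition mean (F : T -> R) : \bar R := (\int[P]_w (F (X w))%:E)%E.
Local Notation "''E' F" := (mean F) (at level 10).
Local Notation "''N'" := (normal_prob (0 : R) 1).

Lemma eq_mean_resample p (F F' : T -> R) : nnmeas F -> nnmeas F' ->
  (forall x, \int['N]_y (F (upd x p y))%:E = \int['N]_y (F' (upd x p y))%:E)%E ->
  'E F = 'E F'.
Proof.
move=> [F0 mF] [F'0 mF'] FF'; rewrite /mean.
rewrite (integral_resample mX PX p F0 mF) (integral_resample mX PX p F'0 mF').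
by apply: eq_integral => w _; exact: FF'.
Qed.

(** Once coordinate [p] is redrawn, [H] factors out of the inner integral; [g] ignores [p], so it
    can be read back on the original vector. *)
Lemma mean_integrate_out p (H f g : T -> R) :
  nnmeas H -> nnmeas f -> nnmeas g -> off (pred1 p) H -> off (pred1 p) g ->
  (forall x, \int['N]_y (f (upd x p y))%:E = (g x)%:E)%E ->
  'E (fun x => H x * f x) = 'E (fun x => H x * g x).
Proof.
move=> nH nf ng oH og fg; apply: (@eq_mean_resample p); try exact: nnmeasM.
move=> x.
under eq_integral do rewrite (off_upd _ _ oH)/= ?eqxx// EFinM.
under [RHS]eq_integral do rewrite (off_upd _ _ oH)/= ?eqxx// (off_upd _ _ og)/= ?eqxx//.
rewrite ge0_integralZl//.
- by rewrite fg integral_cst//= probability_setT mule1.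
- apply/measurable_EFinP; apply: (measurableT_comp nf.2).
  apply: measurable_fspace => q; rewrite /upd.
  by have [_|_] := eqVneq q p => //; exact: measurable_id.
- by move=> y _; rewrite lee_fin nf.1.
- by rewrite lee_fin nH.1.
Qed.

(** Induction on [s]: the factors not yet integrated join [H] for one step, and each resulting [g k]
    joins it for the remaining ones. Hence every [g l] must ignore every coordinate [p k]. *)
Lemma mean_integrate_out_prod (K : eqType) (s : seq K) (p : K -> I)
    (H : T -> R) (f g : K -> T -> R) :
  uniq s -> nnmeas H -> (forall k, nnmeas (f k)) -> (forall k, nnmeas (g k)) ->
  (forall k, off (pred1 (p k)) H) ->
  (forall k l, k != l -> off (pred1 (p k)) (f l)) ->
  (forall k l, off (pred1 (p k)) (g l)) ->
  (forall k x, \int['N]_y (f k (upd x (p k) y))%:E = (g k x)%:E)%E ->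
  'E (fun x => H x * \prod_(k <- s) f k x) =
  'E (fun x => H x * \prod_(k <- s) g k x).
Proof.
move=> us nH nf ng oH ohf og fg.
elim: s us H nH oH => [_ H _ _|k s IH /= /andP[ks us] H nH oH].
  by congr mean; apply/funext => x; rewrite !big_nil.
transitivity ('E (fun x => (H x * \prod_(l <- s) f l x) * f k x)).
  by congr mean; apply/funext => x; rewrite big_cons; ring.
rewrite (@mean_integrate_out (p k) _ _ (g k))//.
- transitivity ('E (fun x => (H x * g k x) * \prod_(l <- s) f l x)).
    by congr mean; apply/funext => x; ring.
  rewrite IH//.
  + by congr mean; apply/funext => x; rewrite big_cons; ring.
  + exact: nnmeasM.
  + by move=> l x x' h; rewrite (oH l x x' h) (og l k x x' h).
- by apply: nnmeasM => //; apply: nnmeas_prod.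
- move=> x x' h; rewrite (oH k x x' h); congr (_ * _).
  apply: eq_big_seq => l ls; apply: (ohf k l) => //.
  by apply: contraNneq ks => ->.
Qed.

Definition shift (s : seq I) (c : I -> T -> R) (x : T) : T :=
  fun q => if q \in s then x q + c q x else x q.

(** Given the other coordinates, [c] is a constant and the one-dimensional formula applies. *)
Lemma mean_shift1 p (c F : T -> R) :
  nnmeas F -> measurable_fun [set: T] c -> off (pred1 p) c ->
  'E (fun x => F (upd x p (x p + c x))) =
  'E (fun x => F x * expR (c x * x p - c x ^+ 2 / 2)).
Proof.
move=> nF mc oc; apply: (@eq_mean_resample p).
- split; first by move=> x; exact: nF.1.
  apply: (measurableT_comp nF.2); apply: measurable_updf.
  by apply: measurable_funD => //; exact: measurable_coord.
- apply: nnmeasM => //; apply: nnmeas_expR; apply: measurable_funB.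
    by apply: measurable_funM => //; exact: measurable_coord.
  by apply: measurable_funM => //; exact: measurable_funX.
move=> x.
under eq_integral do rewrite (off_upd _ _ oc)/= ?eqxx//.
under [RHS]eq_integral do rewrite (off_upd _ _ oc)/= ?eqxx//.
transitivity (\int['N]_y (F (upd x p (y + c x)))%:E)%E.
  by apply: eq_integral => y _; rewrite upd_upd upd_eq.
rewrite (@ge0_integral_normal_shift _ _ (fun y => F (upd x p y))).
- by apply: eq_integral => y _; rewrite upd_eq.
- by move=> y; exact: nF.1.
- apply: (measurableT_comp nF.2); apply: measurable_fspace => q; rewrite /upd.
  by have [_|_] := eqVneq q p => //; exact: measurable_id.
Qed.

(* Cameron-Martin formula; since [c] ignores the shifted coordinates, they can be
   shifted one after the other. *)
Lemma mean_shift (s : seq I) (c : I -> T -> R) (F : T -> R) :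
  uniq s -> (forall p, measurable_fun [set: T] (c p)) ->
  (forall p, off (mem s) (c p)) -> nnmeas F ->
  'E (fun x => F (shift s c x)) =
  'E (fun x => F x * \prod_(p <- s) expR (c p x * x p - c p x ^+ 2 / 2)).
Proof.
move=> + mc; elim: s F => [F _ _ nF|p s IH F /= /andP[ps us] oc nF].
  congr mean; apply/funext => x; rewrite big_nil mulr1.
  by rewrite (_ : shift _ _ _ = x)//; apply/funext => q; rewrite /shift in_nil.
have nE q : nnmeas (fun x : T => expR (c q x * x q - c q x ^+ 2 / 2)).
  apply: nnmeas_expR; apply: measurable_funB.
    by apply: measurable_funM => //; exact: measurable_coord.
  by apply: measurable_funM => //; exact: measurable_funX.
have ocs q : off (mem s) (c q).
  by move=> x x' h; apply: oc => l; rewrite inE negb_or => /andP[_]; exact: h.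
have ocp q : off (pred1 p) (c q).
  by move=> x x' h; apply: oc => l; rewrite inE negb_or => /andP[+ _]; exact: h.
(* The shift along [p :: s] is the shift along [s] followed by one at [p]; the amount [c p] is the
   same before and after the first, since it ignores [s]. *)
transitivity ('E (fun x => (fun y : T => F (upd y p (y p + c p y))) (shift s c x))).
  congr mean; apply/funext => x.
  have -> : c p (shift s c x) = c p x.
    by apply: ocs => q; rewrite /shift /= => /negbTE ->.
  rewrite (_ : shift (p :: s) c x = upd (shift s c x) p (shift s c x p + c p x))//.
  apply/funext => q; rewrite /shift /upd inE.
  by have [->|_] := eqVneq q p => //=; rewrite (negbTE ps).
rewrite (IH (fun y : T => F (upd y p (y p + c p y))))//; last first.
  split; first by move=> x; exact: nF.1.
  apply: (measurableT_comp nF.2); apply: measurable_updf.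
  by apply: measurable_funD => //; exact: measurable_coord.
(* The weight coming from [s] does not involve coordinate [p], so it passes unchanged through the
   shift at [p]. *)
pose W (x : T) := \prod_(q <- s) expR (c q x * x q - c q x ^+ 2 / 2).
have oW : off (pred1 p) W.
  move=> x x' h; apply: eq_big_seq => q qs; rewrite (ocp q x x' h) h//=.
  by apply: contraNneq ps => <-.
transitivity ('E (fun x => (fun y => F y * W y) (upd x p (x p + c p x)))).
  by congr mean; apply/funext => x; rewrite (off_upd _ _ oW)/= ?eqxx.
rewrite (mean_shift1 (F := fun y : T => F y * W y))//; last first.
  by apply: nnmeasM => //; apply: nnmeas_prod => q _; exact: nE.
by congr mean; apply/funext => x; rewrite big_cons /W; ring.
Qed.

End gaussian_vector.

(** * Gaussian integrals with their normalizing constants written in the exponent *)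

Lemma sqrtr_expR (R : realType) (x : R) : 0 < x -> Num.sqrt x = expR (ln x / 2).
Proof.
move=> x0; rewrite -{1}(lnK (x := x)) ?posrE// (splitr (ln x)) expRD -expr2.
by rewrite sqrtr_sqr gtr0_norm ?expR_gt0// -splitr.
Qed.

Lemma integral_normal_expR (R : realType) (a b : R) : -1 < b ->
  (\int[normal_prob 0 1]_y (expR (a * y - b / 2 * y ^+ 2))%:E =
   (expR (a ^+ 2 / (2 * (1 + b)) - ln (1 + b) / 2))%:E)%E.
Proof.
move=> b1; rewrite integral_normal_expR_sqrt// sqrtr_expR; last first.
  by rewrite -ltrBlDl sub0r.
by rewrite expRD expRN mulrC.
Qed.

(** Expanding the square reduces to [integral_normal_expR]. The result is again the exponential of a
    multiple of [q ^+ 2] plus a constant, so further coordinates can be integrated the same way. *)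
Lemma integral_normal_expR_sq (R : realType) (t z q : R) : 2 * t * z ^+ 2 < 1 ->
  (\int[normal_prob 0 1]_y (expR (t * (z * y + q) ^+ 2))%:E =
   (expR (t / (1 - 2 * t * z ^+ 2) * q ^+ 2 - ln (1 - 2 * t * z ^+ 2) / 2))%:E)%E.
Proof.
move=> tz.
have D0 : 1 + - (2 * t * z ^+ 2) != 0 by rewrite gt_eqF// subr_gt0.
transitivity ((expR (t * q ^+ 2))%:E * \int[normal_prob 0 1]_y
  (expR ((2 * t * z * q) * y - (- (2 * t * z ^+ 2)) / 2 * y ^+ 2))%:E)%E.
  rewrite -ge0_integralZl//.
  - apply: eq_integral => y _; rewrite -EFinM -expRD; congr ((expR _)%:E).
    by field.
  - apply/measurable_EFinP; apply: measurableT_comp => //.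
    by apply: measurable_funB => //; exact: measurable_funM.
rewrite integral_normal_expR; last by rewrite ltrN2.
by rewrite -EFinM -expRD; congr ((expR _)%:E); field.
Qed.

(** * Quadratic functionals and shears of a Gaussian matrix *)

Section gaussian_matrix.
Context d (Omega : measurableType d) {R : realType} (P : probability Omega R).
Context {r n : nat} (X : Omega -> fspace R ('I_r * 'I_n)%type).
Hypothesis mX : measurable_fun [set: Omega] X.
Hypothesis PX : forall E : 'I_r * 'I_n -> set R, (forall i, measurable (E i)) ->
  P [set w | forall i, E i (X w i)] = (\prod_i normal_prob 0 1 (E i))%E.
Local Notation T := (fspace R ('I_r * 'I_n)%type).
Local Notation "''E' F" := (mean P X F) (at level 10).
Local Notation "''N'" := (normal_prob (0 : R) 1).

Definition rowdot (z : 'I_n -> R) (k : 'I_r) (x : T) := \sum_j z j * x (k, j).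
Definition sqnorm (z : 'I_n -> R) := \sum_j z j ^+ 2.
Definition mxdot_sq (z : 'I_n -> R) (x : T) := \sum_k rowdot z k x ^+ 2.

Lemma measurable_rowsum (z : 'I_n -> R) k s :
  measurable_fun [set: T] (fun x => \sum_(j <- s) z j * x (k, j)).
Proof.
apply: measurable_sum => j; apply: measurable_funM => //; exact: measurable_coord.
Qed.

Lemma measurable_mxdot_sq z : measurable_fun [set: T] (mxdot_sq z).
Proof.
by apply: measurable_sum => k; apply: measurable_funX; exact: measurable_rowsum.
Qed.

(** Integrating out [(k, j)] turns [t] into [t / (1 - 2 * t * z j ^+ 2)] and leaves the same form on
    the tail of the sum; by the identity [D'E] the logarithms add up. *)
Lemma mean_expR_rowsum (z : 'I_n -> R) (k : 'I_r) (s : seq 'I_n) (t : R) (H : T -> R) :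
  uniq s -> nnmeas H -> off (fun p => p.1 == k) H ->
  2 * t * (\sum_(j <- s) z j ^+ 2) < 1 ->
  'E (fun x => H x * expR (t * (\sum_(j <- s) z j * x (k, j)) ^+ 2)) =
  'E (fun x => H x * expR (- (ln (1 - 2 * t * \sum_(j <- s) z j ^+ 2) / 2))).
Proof.
elim: s t H => [|j s IH] t H /=.
  move=> _ nH _ _; congr mean; apply/funext => x.
  by rewrite !big_nil expr0n/= !mulr0 subr0 ln1 mul0r oppr0.
move=> /andP[js us] nH oH; rewrite big_cons => hts.
set a := \sum_(j <- s) z j ^+ 2 in hts *.
have a0 : 0 <= a by apply: sumr_ge0 => l _; exact: sqr_ge0.
(* Negative [t] is covered too: it arises from negative powers of the density. *)
have hz : 2 * t * z j ^+ 2 < 1.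
  have [t0|t0] := leP 0 t.
    by apply: le_lt_trans hts; rewrite ler_wpM2l ?mulr_ge0// lerDl.
  by apply: le_lt_trans ltr01; rewrite mulr_le0_ge0 ?sqr_ge0// pmulr_rle0// ltW.
have D0 : 0 < 1 - 2 * t * z j ^+ 2 by rewrite subr_gt0.
set t' := t / (1 - 2 * t * z j ^+ 2).
have D'E : 1 - 2 * t' * a = (1 - 2 * t * (z j ^+ 2 + a)) / (1 - 2 * t * z j ^+ 2).
  by rewrite /t'; field; rewrite gt_eqF.
have D'0 : 0 < 1 - 2 * t' * a by rewrite D'E divr_gt0// subr_gt0.
pose c0 := - (ln (1 - 2 * t * z j ^+ 2) / 2).
transitivity ('E (fun x => H x *
    expR (t' * (\sum_(l <- s) z l * x (k, l)) ^+ 2 + c0))).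
  apply: (@mean_integrate_out _ _ _ _ _ _ mX PX (k, j)) => //.
  - apply: nnmeas_expR; apply: measurable_funM => //; apply: measurable_funX.
    exact: measurable_rowsum.
  - apply: nnmeas_expR; apply: measurable_funD => //; apply: measurable_funM => //.
    by apply: measurable_funX; exact: measurable_rowsum.
  - move=> x x' h; apply: oH => q qk; apply: h => /=.
    by apply: contraNneq qk => ->.
  - move=> x x' h; congr (expR (_ * _ ^+ 2 + _)); apply: eq_big_seq => l ls.
    by rewrite h//=; apply: contraNneq js => -[<-].
  - move=> x; rewrite -integral_normal_expR_sq//.
    apply: eq_integral => y _; rewrite big_cons upd_eq; congr ((expR (_ * (_ + _) ^+ 2))%:E).
    apply: eq_big_seq => l ls; rewrite /upd; case: eqP => // -[lj].
    by rewrite lj (negbTE js) in ls.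
transitivity ('E (fun x => (H x * expR c0) * expR (t' * (\sum_(l <- s) z l * x (k, l)) ^+ 2))).
  by congr mean; apply/funext => x; rewrite expRD; ring.
rewrite IH//.
- congr mean; apply/funext => x; rewrite -mulrA -expRD; congr (_ * expR _).
  by rewrite D'E ln_div ?posrE ?subr_gt0// /c0; field.
- by apply: nnmeasM => //; apply: nnmeas_cst; exact: expR_ge0.
- by move=> x x' h; rewrite (oH x x' h).
- by rewrite -subr_gt0.
Qed.

Lemma mean_cst (c : R) : 'E (fun=> c) = c%:E.
Proof. by rewrite /mean integral_cst//= probability_setT mule1. Qed.

(** The [rowdot z k] are independent centred normals of variance [sqnorm z], so this is the moment
    generating function of a scaled chi-square law with [r] degrees of freedom. *)
Lemma mean_expR_mxdot_sq (z : 'I_n -> R) (t : R) : 2 * t * sqnorm z < 1 ->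
  'E (fun x => expR (t * mxdot_sq z x)) =
  (expR (- (r%:R / 2 * ln (1 - 2 * t * sqnorm z))))%:E.
Proof.
move=> tz; set C := expR (- (ln (1 - 2 * t * sqnorm z) / 2)).
(* The free factor [c] collects the constants of the rows already integrated. *)
suff H (s : seq 'I_r) (c : R) : uniq s -> 0 <= c ->
    'E (fun x => c * \prod_(k <- s) expR (t * rowdot z k x ^+ 2)) =
    (c * C ^+ size s)%:E.
  transitivity ('E (fun x => 1 * \prod_(k <- enum 'I_r) expR (t * rowdot z k x ^+ 2))).
    congr mean; apply/funext => x; rewrite mul1r -expR_sum big_enum/=.
    by rewrite -mulr_sumr.
  rewrite H ?enum_uniq// size_enum_ord mul1r -expRM_natl; congr ((expR _)%:E).
  by field.
elim: s c => [c _ c0|k s IH c /= /andP[ks us] c0].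
  by under eq_fun do rewrite big_nil; rewrite mean_cst.
transitivity ('E (fun x => (c * \prod_(l <- s) expR (t * rowdot z l x ^+ 2)) *
    expR (t * (\sum_(j <- enum 'I_n) z j * x (k, j)) ^+ 2))).
  by congr mean; apply/funext => x; rewrite big_cons big_enum /rowdot; ring.
rewrite mean_expR_rowsum ?enum_uniq//; first last.
- by rewrite big_enum.
- move=> x x' h; congr (_ * _); apply: eq_big_seq => l ls.
  congr (expR (_ * _ ^+ 2)); apply: eq_bigr => j _; rewrite h//=.
  by apply: contraNneq ks => <-.
- apply: nnmeasM; first exact: nnmeas_cst.
  apply: nnmeas_prod => l _; apply: nnmeas_expR; apply: measurable_funM => //.
  by apply: measurable_funX; exact: measurable_rowsum.
rewrite big_enum/= -/(sqnorm z) -/C.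
transitivity ('E (fun x => (c * C) * \prod_(l <- s) expR (t * rowdot z l x ^+ 2))).
  by congr mean; apply/funext => x; ring.
by rewrite IH ?mulr_ge0 ?expR_ge0// exprS mulrA.
Qed.

(* The log-density at [x] of the law of [X + X_i z^T] relative to the law of [X],
   where [X_i] is a column of [X] which is not observed. *)
Definition shear_logdens (z : 'I_n -> R) (x : T) : R :=
  mxdot_sq z x / (2 * (1 + sqnorm z)) - r%:R / 2 * ln (1 + sqnorm z).

Lemma sqnorm_ge0 z : 0 <= sqnorm z.
Proof. by apply: sumr_ge0 => j _; exact: sqr_ge0. Qed.

(** With column [i] frozen, the map shifts the other columns and [mean_shift] applies. Since [F]
    ignores column [i], that column is then integrated out of the weight, row by row. *)
Lemma mean_shear (i : 'I_n) (z : 'I_n -> R) (F : T -> R) : z i = 0 ->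
  nnmeas F -> off (fun p => p.2 == i) F ->
  'E (fun x => F (fun p => x p + x (p.1, i) * z p.2)) =
  'E (fun x => F x * expR (shear_logdens z x)).
Proof.
move=> zi nF oF.
pose s := [seq p <- enum {: 'I_r * 'I_n} | p.2 != i].
pose c (p : 'I_r * 'I_n) (x : T) := x (p.1, i) * z p.2.
have us : uniq s by rewrite filter_uniq// enum_uniq.
have mc p : measurable_fun [set: T] (c p).
  by apply: measurable_funM => //; exact: measurable_coord.
have rowdot_off k l x x' : (forall q, q != (k, i) -> x q = x' q) ->
    rowdot z l x = rowdot z l x'.
  move=> h; apply: eq_bigr => j _; have [->|ji] := eqVneq j i; first by rewrite zi !mul0r.
  by rewrite h//; apply: contraNneq ji => -[_ ->].
transitivity ('E (fun x => F (shift s c x))).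
  congr mean; apply/funext => x; rewrite (_ : shift s c x = (fun p => x p + x (p.1, i) * z p.2))//.
  apply/funext => -[k j]; rewrite /shift mem_filter mem_enum andbT /c /=.
  by have [->|//] := eqVneq j i; rewrite zi mulr0 addr0.
rewrite (mean_shift mX PX us mc)//; last first.
  by move=> p x x' h; rewrite /c h//= mem_filter /= eqxx.
(* [f k] is the Cameron-Martin weight of row [k]. As [z i = 0], [rowdot z k] is free of [x (k, i)],
   so the exponent is quadratic in that coordinate; [g k] is the integral over it. *)
pose f k (x : T) := expR (rowdot z k x * x (k, i) - sqnorm z / 2 * x (k, i) ^+ 2).
pose g k (x : T) := expR (rowdot z k x ^+ 2 / (2 * (1 + sqnorm z)) - ln (1 + sqnorm z) / 2).
transitivity ('E (fun x => F x * \prod_(k <- enum 'I_r) f k x)).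
  congr mean; apply/funext => x; congr (_ * _).
  rewrite /f -!expR_sum; congr expR; rewrite /s big_filter !big_enum_cond/=.
  transitivity (\sum_(k < r) \sum_(j < n | j != i)
      (c (k, j) x * x (k, j) - c (k, j) x ^+ 2 / 2)).
    by rewrite pair_big_dep/=; apply: eq_big => -[k j].
  apply: eq_bigr => k _; rewrite /rowdot /sqnorm !mulr_suml -sumrB big_mkcond/=.
  apply: eq_bigr => j _; rewrite /c /=; have [->|_] /= := eqVneq j i.
    by rewrite zi; ring.
  by field.
rewrite (mean_integrate_out_prod mX PX (p := fun k => (k, i)) (g := g)) ?enum_uniq//.
- congr mean; apply/funext => x; congr (_ * _).
  rewrite /g -expR_sum big_enum/= sumrB -mulr_suml; congr (expR (_ - _)).
  by rewrite sumr_const card_ord -mulr_natl; field.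
- move=> k; apply: nnmeas_expR; apply: measurable_funB.
    apply: measurable_funM; first exact: measurable_rowsum.
    exact: measurable_coord.
  apply: measurable_funM => //; apply: measurable_funX; exact: measurable_coord.
- move=> k; apply: nnmeas_expR; apply: measurable_funB => //.
  by apply: measurable_funM => //; apply: measurable_funX; exact: measurable_rowsum.
- move=> k x x' h; apply: oF => q qi; apply: h => /=.
  by apply: contraNneq qi => ->.
- move=> k l kl x x' h; rewrite /f (rowdot_off k l x x' h) h//=.
  by apply: contraNneq kl => -[->].
- by move=> k l x x' h; rewrite /g (rowdot_off k l x x' h).
- move=> k x; rewrite /g -integral_normal_expR; last first.
    by apply: lt_le_trans (sqnorm_ge0 z); rewrite ltrN10.
  apply: eq_integral => y _; rewrite /f upd_eq (rowdot_off k k _ x)//.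
  by move=> q /negbTE qk; rewrite /upd qk.
Qed.

End gaussian_matrix.

(** * Elementary lower bounds on the logarithm *)

Section logarithm_bounds.
Context {R : realType}.
Implicit Types x a u : R.

(** Apply [ln (1 + x) <= x] at [x = - (a / (1 + a))], where [1 + x] is [(1 + a)^-1]. *)
Lemma ln1D_ge_frac a : 0 <= a -> a / (1 + a) <= ln (1 + a).
Proof.
move=> a0; have a1 : 0 < 1 + a by lra.
have N1 : -1 < - (a / (1 + a)).
  by rewrite ltrN2 ltr_pdivrMr// mul1r; lra.
have := le_ln1Dx N1.
rewrite (_ : 1 + - (a / (1 + a)) = (1 + a)^-1); last by field; rewrite gt_eqF.
by rewrite lnV ?posrE// lerN2.
Qed.

Lemma ln1B_ge_frac x : x < 1 -> - (x / (1 - x)) <= ln (1 - x).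
Proof.
move=> x1; have x0 : 0 < 1 - x by lra.
have N1 : -1 < x / (1 - x) by rewrite ltr_pdivlMr// mulN1r; lra.
have := le_ln1Dx N1.
rewrite (_ : 1 + x / (1 - x) = (1 - x)^-1); last by field; rewrite gt_eqF.
by rewrite lnV ?posrE//; lra.
Qed.

(** The difference of the two sides vanishes at [u = 0] and, as a function of [x = 1 + u], has
    derivative [(x - 1) ^+ 2 / x]. *)
Lemma ln1D_ge_quad u : 0 <= u -> u - u ^+ 2 / 2 <= ln (1 + u).
Proof.
move=> u0.
pose f (x : R) : R := ln x - (x - (x - 1) ^+ 2 / 2).
pose df (x : R) : R := x^-1 - (1 - (x - 1)).
have der x : 0 < x -> is_derive x 1 f (df x).
  move=> x0; rewrite /f /df.
  have lnx := is_derive1_ln x0.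
  apply: is_derive_eq.
  by rewrite !scaler0 !add0r /GRing.scale/=; field; rewrite gt_eqF.
have [| | |c] := @MVT_segment R f df 1 (1 + u).
- by lra.
- by move=> x; rewrite in_itv/= => /andP[x1 _]; apply: der; lra.
- apply: derivable_within_continuous => x; rewrite in_itv/= => /andP[x1 _].
  by apply: ex_derive; apply: der; lra.
rewrite in_itv/= => /andP[c1 _] fE.
have : 0 <= f (1 + u) - f 1.
  rewrite fE mulr_ge0//; last by lra.
  have c0 : 0 < c by lra.
  rewrite /df (_ : _ - _ = (c - 1) ^+ 2 / c); last by field; rewrite gt_eqF.
  by rewrite divr_ge0 ?sqr_ge0// ltW.
by rewrite /f ln1; nra.
Qed.

End logarithm_bounds.

(** * Choice of the moment orders and the resulting error exponents *)

Section parameters.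
Context {R : realType}.
Implicit Types eps L rho sigma a b x c : R.

(** Square [x * sigma <= L * (1 - x)] and cancel one factor [L]. *)
Lemma quad_le_of_mul_sqrt_le L rho sigma x :
  0 < L -> 0 < rho -> 0 < sigma -> sigma ^+ 2 = 2 * rho * L ->
  0 <= x -> x * (sigma + L) <= L ->
  x < 1 /\ 2 * rho * x ^+ 2 <= L * (1 - x) ^+ 2.
Proof.
move=> L0 rho0 sigma0 sigmaE x0 xL; have x1 : x < 1 by nra.
split=> //.
have h : x * sigma <= L * (1 - x) by nra.
have : (x * sigma) ^+ 2 <= (L * (1 - x)) ^+ 2.
  by rewrite ler_sqr// nnegrE ?mulr_ge0//; lra.
rewrite !exprMn sigmaE => h2.
by rewrite -(ler_pM2l L0); lra.
Qed.

(** [T] equals [2 * (eps + L) * (sigma + L) / (eps * L)], which makes the left side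
    [c * L * (a * T)]. The values 2 and 4 of [c] give the two moment orders below. *)
Lemma scaled_le eps L sigma c a (T := (1 + eps / L) / eps * (2 * sigma + 2 * L)) :
  0 < eps -> 0 < L -> 0 <= c -> a * T <= 1 ->
  (c * (eps + L) / eps * a) * (2 * (sigma + L)) <= c * L.
Proof.
rewrite /T => eps0 L0 c0 aT.
have -> : c * (eps + L) / eps * a * (2 * (sigma + L)) =
  c * L * (a * ((1 + eps / L) / eps * (2 * sigma + 2 * L))).
  by field; rewrite !gt_eqF.
by rewrite ler_piMr// mulr_ge0// ltW.
Qed.

(** Makes the error in [mean_shear_le] at most [expR (- L)]. The leading term is
    [5 / 4 * (eps + L)]; the parts of the two logarithms linear in [x = lam * a] cancel, and the
    remainders cost at most [eps / 8 + L / 4]. *)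
Lemma remove_row_exponent eps L rho sigma a (lam := 2 * (eps + L) / eps)
    (T := (1 + eps / L) / eps * (2 * sigma + 2 * L)) :
  0 < eps -> 0 < L -> 0 < rho -> 0 < sigma -> sigma ^+ 2 = 2 * rho * L ->
  0 <= a -> a * T <= 1 ->
  lam * a < 1 /\
  L <= lam * (5 / 8 * eps) + rho / 2 * lam * ln (1 + a) + rho / 2 * ln (1 - lam * a).
Proof.
move=> eps0 L0 rho0 sigma0 sigmaE a0 aT.
have lam0 : 0 < lam by rewrite divr_gt0// mulr_gt0//; lra.
have lamE : lam * eps = 2 * (eps + L) by rewrite /lam divfK// gt_eqF.
set x := lam * a.
have x0 : 0 <= x by rewrite mulr_ge0// ltW.
have [|x1 xq] := quad_le_of_mul_sqrt_le L0 rho0 sigma0 sigmaE x0.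
  by have := scaled_le eps0 L0 (ler0n _ 2) aT; rewrite -/lam -/x; lra.
split=> //.
have l1 := ln1D_ge_frac a0.
have l2 := ln1B_ge_frac x1.
have l1' : x - a * x <= lam * ln (1 + a).
  apply: le_trans (ler_wpM2l (ltW lam0) l1).
  rewrite (_ : x - a * x = lam * (a - a ^+ 2)); last by rewrite /x; ring.
  rewrite ler_wpM2l ?(ltW lam0)// ler_pdivlMr; last by lra.
  by nra.
(* Here [x / (1 - x)] is [x + x ^+ 2 / (1 - x)], and [xq] bounds [rho * x ^+ 2] by
   [L * (1 - x) ^+ 2 / 2]. *)
have l2' : rho * (x / (1 - x)) <= rho * x + L / 2.
  have x1' : 0 < 1 - x by lra.
  have : 0 <= L * ((1 - x) * x) by apply: mulr_ge0; [exact: ltW|apply: mulr_ge0 => //; lra].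
  by rewrite mulrA ler_pdivrMr//; lra.
(* Multiplied by [lam], the left side is [rho * x ^+ 2], at most [L / 2], and the right side is
   [(eps + L) / 2]. *)
have ax : rho * (a * x) <= eps / 4.
  have : rho * (a * x) * lam <= eps / 4 * lam.
    rewrite (_ : rho * (a * x) * lam = rho * x ^+ 2); last by rewrite /x; ring.
    have : 0 <= L * ((1 - x) * x) by apply: mulr_ge0; [exact: ltW|apply: mulr_ge0 => //; lra].
    by nra.
  by rewrite ler_pM2r.
have -> : rho / 2 * lam * ln (1 + a) = rho / 2 * (lam * ln (1 + a)) by ring.
have m1 : rho / 2 * (x - a * x) <= rho / 2 * (lam * ln (1 + a)).
  by rewrite ler_pM2l//; lra.
have m2 : - (rho / 2 * (x / (1 - x))) <= rho / 2 * ln (1 - x).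
  by rewrite -mulrN ler_pM2l//; lra.
by lra.
Qed.

(** Counterpart for [mean_le_shear]; the extra [5 / 8 * eps] pays for the factor that the first
    comparison puts on this error. The leading term is [3 / 2 * (eps + L)], and the logarithms
    consume at most [eps / 4 + L / 2]. *)
Lemma add_row_exponent eps L rho sigma b (lam := 4 * (eps + L) / eps)
    (T := (1 + eps / L) / eps * (2 * sigma + 2 * L)) :
  0 < eps -> 0 < L -> 0 < rho -> 0 < sigma -> sigma ^+ 2 = 2 * rho * L ->
  0 <= b -> b * T <= 1 ->
  L + 5 / 8 * eps <= lam * (3 / 8 * eps) - rho / 2 * lam * ln (1 + b)
    + rho / 2 * ln (1 + lam * b / (1 + b)).
Proof.
move=> eps0 L0 rho0 sigma0 sigmaE b0 bT.
have lam0 : 0 < lam by rewrite divr_gt0// mulr_gt0//; lra.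
have lamE : lam * eps = 4 * (eps + L) by rewrite /lam divfK// gt_eqF.
set y := lam * b.
have y0 : 0 <= y by rewrite mulr_ge0// ltW.
have y20 : 0 <= y / 2 by lra.
have [|x1 xq] := quad_le_of_mul_sqrt_le L0 rho0 sigma0 sigmaE y20.
  by have := scaled_le eps0 L0 (ler0n _ 4) bT; rewrite -/lam -/y; lra.
have yq : rho * y ^+ 2 <= 2 * L.
  have : 0 <= L * (y / 2 * (2 - y / 2)).
    by apply: mulr_ge0; [exact: ltW|apply: mulr_ge0 => //; lra].
  by lra.
have b1 : 0 < 1 + b by lra.
set u := y / (1 + b).
have u0 : 0 <= u by rewrite divr_ge0// ltW.
have uy : u <= y by rewrite ler_pdivrMr//; nra.
have uE : u * (1 + b) = y by rewrite divfK// gt_eqF.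
have l1 : lam * ln (1 + b) <= y.
  by rewrite ler_pM2l//; apply: le_ln1Dx; lra.
have l2 := ln1D_ge_quad u0.
have yb : rho * (y * b) <= eps / 2.
  have : rho * (y * b) * lam <= eps / 2 * lam.
    rewrite (_ : rho * (y * b) * lam = rho * y ^+ 2); last by rewrite /y; ring.
    by nra.
  by rewrite ler_pM2r.
(* By [uE], [y - u] is [u * b]. *)
have yu : rho * (y - u) <= rho * (y * b).
  by rewrite ler_pM2l//; nra.
have uu : rho * u ^+ 2 <= rho * y ^+ 2.
  by rewrite ler_pM2l// ler_sqr// nnegrE.
have m1 : rho / 2 * (lam * ln (1 + b)) <= rho / 2 * y.
  by rewrite ler_pM2l//; lra.
have m2 : rho / 2 * (u - u ^+ 2 / 2) <= rho / 2 * ln (1 + u).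
  by rewrite ler_pM2l//; lra.
have -> : rho / 2 * lam * ln (1 + b) = rho / 2 * (lam * ln (1 + b)) by ring.
by lra.
Qed.

End parameters.

(** * Privacy loss of a shear, tested on an indicator [F] *)

Section shear_privacy.
Context d (Omega : measurableType d) {R : realType} (P : probability Omega R).
Context {r n : nat} (X : Omega -> fspace R ('I_r * 'I_n)%type).
Hypothesis mX : measurable_fun [set: Omega] X.
Hypothesis PX : forall E : 'I_r * 'I_n -> set R, (forall i, measurable (E i)) ->
  P [set w | forall i, E i (X w i)] = (\prod_i normal_prob 0 1 (E i))%E.
Local Notation T := (fspace R ('I_r * 'I_n)%type).
Local Notation "''E' F" := (mean P X F) (at level 10).
Variables (i : 'I_n) (z : 'I_n -> R) (F : T -> R).
Hypotheses (zi : z i = 0) (F01 : forall x, F x = 0 \/ F x = 1).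
Hypotheses (mF : measurable_fun [set: T] F) (oF : off (fun p => p.2 == i) F).
Local Notation a := (sqnorm z).
Local Notation sheared := (fun x : T => F (fun p => x p + x (p.1, i) * z p.2)).

Let nF : nnmeas F.
Proof. by split=> // x; case: (F01 x) => ->. Qed.

Let mlog : measurable_fun [set: T] (shear_logdens z).
Proof.
by apply: measurable_funB => //; apply: measurable_funM => //; exact: measurable_mxdot_sq.
Qed.

Let mean_affine (k : R) (f g h : T -> R) : 0 <= k ->
  nnmeas f -> nnmeas g -> nnmeas h ->
  (forall x, h x <= k * f x + g x) ->
  ('E h <= k%:E * 'E f + 'E g)%E.
Proof.
move=> k0 nf ng nh hfg; rewrite /mean.
have mE (u : T -> R) : nnmeas u -> measurable_fun [set: Omega] (fun w => (u (X w))%:E).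
  by move=> nu; apply/measurable_EFinP; exact: (measurableT_comp nu.2 mX).
have nkf := nnmeasM (nnmeas_cst _ k0) nf.
rewrite -ge0_integralZl//; [|exact: mE|by move=> w _; rewrite lee_fin nf.1].
rewrite -ge0_integralD//; first last.
- exact: mE.
- by move=> w _; rewrite lee_fin ng.1.
- exact: (mE _ nkf).
- by move=> w _; rewrite -EFinM lee_fin nkf.1.
apply: ge0_le_integral => //.
- by move=> w _; rewrite lee_fin nh.1.
- exact: mE.
- exact: (mE _ (nnmeasD nkf ng)).
- by move=> w _; rewrite -EFinM -EFinD lee_fin.
Qed.

(** [shear_logdens z] is affine in [mxdot_sq z], so its exponential moments are those of
    [mxdot_sq z] at [s = t / (2 * (1 + a))]. *)
Let mean_expR_logdens (t c : R) : t * a < 1 + a ->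
  'E (fun x => expR (t * shear_logdens z x + c)) =
  (expR (c - r%:R / 2 * (t * ln (1 + a) + ln (1 - t * a / (1 + a)))))%:E.
Proof.
move=> ta.
have a1 : 0 < 1 + a by have := sqnorm_ge0 z; lra.
pose s := t / (2 * (1 + a)).
pose c' := c - t * (r%:R / 2 * ln (1 + a)).
have sE : 2 * s * a = t * a / (1 + a) by rewrite /s; field; rewrite gt_eqF.
transitivity ('E (fun x => expR c' * expR (s * mxdot_sq z x))).
  congr mean; apply/funext => x; rewrite -expRD; congr expR.
  by rewrite /shear_logdens /c' /s; field; rewrite gt_eqF.
rewrite /mean; under eq_integral do rewrite EFinM.
rewrite ge0_integralZl//; last first.
  apply/measurable_EFinP; apply: measurableT_comp => //.
  apply: measurable_funM => //; exact: (measurableT_comp (measurable_mxdot_sq z) mX).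
have := mean_expR_mxdot_sq mX PX (z := z) (t := s); rewrite /mean => ->; last first.
  by rewrite sE ltr_pdivrMr// mul1r.
rewrite -EFinM -expRD sE; congr ((expR _)%:E).
by rewrite /c'; ring.
Qed.

(* Markov's inequality for a power of the likelihood ratio of the sheared law. *)
Lemma mean_shear_le (e lam : R) : 0 <= lam -> lam * a < 1 ->
  ('E sheared <= (expR e)%:E * 'E F +
    (expR (- (lam * e + r%:R / 2 * lam * ln (1 + a) + r%:R / 2 * ln (1 - lam * a))))%:E)%E.
Proof.
move=> lam0 lama.
have a1 : 0 < 1 + a by have := sqnorm_ge0 z; lra.
have la1 : 0 < 1 - lam * a by lra.
rewrite (mean_shear mX PX zi nF oF).
(* Where the log-density exceeds [e], [g] dominates the density; elsewhere the density is at most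
   [expR e]. The order is [1 + lam] because the density itself is being integrated. *)
pose g (x : T) := expR ((1 + lam) * shear_logdens z x + - (lam * e)).
have ng : nnmeas g.
  by apply: nnmeas_expR; apply: measurable_funD => //; exact: measurable_funM.
have -> : (expR (- (lam * e + r%:R / 2 * lam * ln (1 + a) +
    r%:R / 2 * ln (1 - lam * a))))%:E = 'E g.
  rewrite mean_expR_logdens; last by lra.
  congr ((expR _)%:E).
  rewrite (_ : 1 - (1 + lam) * a / (1 + a) = (1 - lam * a) / (1 + a)); last first.
    by field; rewrite gt_eqF.
  by rewrite ln_div ?posrE//; field.
apply: mean_affine => //.
  by apply: nnmeasM => //; exact: nnmeas_expR.
move=> x; case: (F01 x) => ->; first by rewrite mulr0 mul0r add0r expR_ge0.
rewrite mul1r mulr1; have [h|h] := leP (shear_logdens z x) e.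
  by rewrite (@le_trans _ _ (expR e)) ?ler_expR// lerDl expR_ge0.
rewrite (@le_trans _ _ (g x)) ?lerDr ?expR_ge0// ler_expR; nra.
Qed.

(** The bad event is now a density below [expR (- e)]; on it the function [g], built from the power
    [- lam] of the density, is at least 1. *)
Lemma mean_le_shear (e lam : R) : 0 <= lam ->
  ('E F <= (expR e)%:E * 'E sheared +
    (expR (- (lam * e - r%:R / 2 * lam * ln (1 + a)
              + r%:R / 2 * ln (1 + lam * a / (1 + a)))))%:E)%E.
Proof.
move=> lam0.
have a0 := sqnorm_ge0 z; have a1 : 0 < 1 + a by lra.
rewrite (mean_shear mX PX zi nF oF).
pose g (x : T) := expR (- lam * shear_logdens z x + - (lam * e)).
have ng : nnmeas g.
  by apply: nnmeas_expR; apply: measurable_funD => //; exact: measurable_funM.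
have -> : (expR (- (lam * e - r%:R / 2 * lam * ln (1 + a) +
    r%:R / 2 * ln (1 + lam * a / (1 + a)))))%:E = 'E g.
  rewrite mean_expR_logdens; last by nra.
  by congr ((expR _)%:E); rewrite !mulNr opprK; ring.
apply: mean_affine => //.
  by apply: nnmeasM => //; exact: nnmeas_expR.
move=> x; case: (F01 x) => ->; first by rewrite mul0r mulr0 add0r expR_ge0.
rewrite mul1r -expRD; have [h|h] := leP 0 (e + shear_logdens z x).
  by rewrite (@le_trans _ _ (expR (e + shear_logdens z x))) ?lerDl ?expR_ge0// -expR0 ler_expR.
rewrite (@le_trans _ _ (g x)) ?lerDr ?expR_ge0// -expR0 ler_expR; nra.
Qed.

End shear_privacy.

(** * Sums of squares and Gram matrices *)

Section euclidean.
Context {R : realType}.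

Definition sumsq n (v : 'cV[R]_n) : R := \sum_j v j 0 ^+ 2.
Definition dot n (u v : 'cV[R]_n) : R := \sum_j u j 0 * v j 0.

Lemma sumsq_ge0 n (v : 'cV[R]_n) : 0 <= sumsq v.
Proof. by apply: sumr_ge0 => j _; exact: sqr_ge0. Qed.

Lemma sumsq_eq0 n (v : 'cV[R]_n) : sumsq v <= 0 -> v = 0.
Proof.
move=> v0; have /eqP : sumsq v = 0 by apply/eqP; rewrite eq_le v0 sumsq_ge0.
rewrite psumr_eq0; last by move=> j _; exact: sqr_ge0.
move=> /allP h; apply/matrixP => j k; rewrite ord1 mxE.
by apply/eqP; rewrite -sqrf_eq0; apply: h; rewrite mem_index_enum.
Qed.

Lemma sumsq_lin n (s t : R) (u v : 'cV[R]_n) :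
  sumsq (s *: u + t *: v) = s ^+ 2 * sumsq u + 2 * s * t * dot u v + t ^+ 2 * sumsq v.
Proof.
rewrite /sumsq /dot !mulr_sumr -!big_split/=.
by apply: eq_bigr => j _; rewrite !mxE; ring.
Qed.

(** Cauchy-Schwarz: expand the squared norm of [sumsq v *: u - dot u v *: v] and divide by
    [sumsq v]. *)
Lemma dot_sqr_le n (u v : 'cV[R]_n) : dot u v ^+ 2 <= sumsq u * sumsq v.
Proof.
have [v0|v0] := leP (sumsq v) 0.
  rewrite (sumsq_eq0 v0) /dot big1 ?expr0n/=; last by move=> j _; rewrite mxE mulr0.
  by rewrite mulr_ge0// sumsq_ge0.
have := sumsq_ge0 (sumsq v *: u + (- dot u v) *: v).
rewrite sumsq_lin => h.
by rewrite -(ler_pM2l v0); lra.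
Qed.

Lemma sumsq_mulmx n d (A : 'M[R]_(n, d)) (y : 'cV[R]_d) :
  sumsq (A *m y) = dot (A^T *m (A *m y)) y.
Proof.
have dotE k (u v : 'cV[R]_k) : dot u v = (u^T *m v) 0 0.
  by rewrite mxE; apply: eq_bigr => j _; rewrite mxE.
have sE : sumsq (A *m y) = dot (A *m y) (A *m y) by [].
by rewrite sE !dotE [in RHS]trmx_mul trmxK -mulmxA.
Qed.

(** The lower bound makes the Gram matrix invertible, and [y] is its inverse applied to [v]. Then
    [sumsq (A *m y)] is [dot v y], which is bounded by expanding [0 <= sumsq (v - m *: y)]. *)
Lemma exists_row_combination n d (A : 'M[R]_(n, d)) (m c : R) (v : 'cV[R]_d) :
  0 < m -> (forall y, m * sumsq y <= sumsq (A *m y)) -> sumsq v <= c ->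
  exists y : 'cV[R]_d, A^T *m (A *m y) = v /\ m * sumsq (A *m y) <= c.
Proof.
move=> m0 hA vc.
have uN : A^T *m A \in unitmx.
  rewrite unitmxE unitfE; apply/negP => /det0P[u u0 uN].
  have /eqP := u0; apply; apply: trmx_inj; rewrite trmx0; apply: sumsq_eq0.
  rewrite -(ler_pM2l m0) mulr0; apply: le_trans (hA _) _.
  have N0 : A^T *m (A *m u^T) = 0.
    by apply: trmx_inj; rewrite trmx0 !trmx_mul !trmxK -mulmxA.
  by rewrite sumsq_mulmx N0 /dot big1// => j _; rewrite mxE mul0r.
exists (invmx (A^T *m A) *m v); set y := _ *m v.
have yv : A^T *m (A *m y) = v by rewrite mulmxA /y mulmxA mulmxV// mul1mx.
split=> //.
have := sumsq_ge0 (1 *: v + (- m) *: y); rewrite sumsq_lin.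
have := hA y; rewrite sumsq_mulmx yv.
move: (dot v y) (sumsq y) => p q hq h; nra.
Qed.

End euclidean.

(** * Erasing the row in which neighbors differ *)

Section neighboring_matrices.
Context {R : realType} {n d : nat}.
Implicit Types A : 'M[R]_(n, d).

Lemma sigma_min_le A (w : R) (y : 'cV[R]_d) : 0 <= w -> w <= sigma_min A ->
  w ^+ 2 * sumsq y <= sumsq (A *m y).
Proof.
move=> w0 wA.
(* A zero [y] cannot be normalized; this case also covers [d = 0], where the infimum is over the
   empty set. *)
have [y0|y0] := leP (sumsq y) 0.
  by rewrite (sumsq_eq0 y0) mulmx0 /sumsq !big1 ?mulr0// => j _; rewrite mxE expr0n.
set s := Num.sqrt (sumsq y).
have s0 : 0 < s by rewrite sqrtr_gt0.
have s2 : s ^+ 2 = sumsq y by rewrite sqr_sqrtr// ltW.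
have sumsqZ k (c : R) (u : 'cV[R]_k) : sumsq (c *: u) = c ^+ 2 * sumsq u.
  by rewrite /sumsq mulr_sumr; apply: eq_bigr => j _; rewrite mxE exprMn.
have : w <= cnorm (A *m (s^-1 *: y)).
  apply: le_trans wA _; apply: ge_inf.
    by exists 0 => _ [x _ <-]; exact: sqrtr_ge0.
  exists (s^-1 *: y) => //=; rewrite /cnorm -/(sumsq _) sumsqZ -s2 exprVn.
  by rewrite mulVf ?sqrtr1// sqrf_eq0 gt_eqF.
rewrite /cnorm -/(sumsq _) -scalemxAr sumsqZ => h.
have : w ^+ 2 <= s^-1 ^+ 2 * sumsq (A *m y).
  rewrite -[leRHS]sqr_sqrtr; last by rewrite mulr_ge0 ?sqr_ge0// sumsq_ge0.
  by rewrite ler_sqr// nnegrE sqrtr_ge0.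
by rewrite exprVn s2 mulrC ler_pdivlMr.
Qed.

Definition zero_row (i : 'I_n) A : 'M[R]_(n, d) :=
  \matrix_(k, j) if k == i then 0 else A k j.

Lemma zero_row_mulmx i A (y : 'cV[R]_d) :
  sumsq (zero_row i A *m y) = sumsq (A *m y) - dot (row i A)^T y ^+ 2.
Proof.
rewrite /sumsq (bigD1 i)//= [in RHS](bigD1 i)//=.
have -> : (zero_row i A *m y) i 0 = 0.
  by rewrite mxE big1// => j _; rewrite mxE eqxx mul0r.
have -> : (A *m y) i 0 = dot (row i A)^T y.
  by rewrite mxE; apply: eq_bigr => j _; rewrite !mxE.
rewrite expr0n/= add0r [RHS]addrC addKr; apply: eq_bigr => k ki; congr (_ ^+ 2).
by rewrite !mxE; apply: eq_bigr => j _; rewrite mxE (negbTE ki).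
Qed.

Lemma rows_bounded_sumsq A (B : R) i : 0 <= B -> rows_bounded B A ->
  sumsq (row i A)^T <= B ^+ 2.
Proof.
move=> B0 /(_ i); rewrite /rnorm => h.
have -> : sumsq (row i A)^T = \sum_j row i A 0 j ^+ 2.
  by apply: eq_bigr => j _; rewrite mxE.
rewrite -[leLHS]sqr_sqrtr; last by apply: sumr_ge0 => j _; exact: sqr_ge0.
by rewrite ler_sqr ?nnegrE ?sqrtr_ge0.
Qed.

(* Erasing a row of norm at most [B] lowers the Gram form [|A y|^2] by at most
   [B^2 |y|^2], hence the denominator [w^2 - B^2]. *)
Lemma removed_row_combination A (B w : R) i :
  0 <= B -> B < w -> rows_bounded B A -> w <= sigma_min A ->
  exists z : 'I_n -> R, [/\ z i = 0, sqnorm z * (w ^+ 2 - B ^+ 2) <= B ^+ 2 &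
    forall j, \sum_k z k * zero_row i A k j = A i j].
Proof.
move=> B0 Bw hB hw; have w0 : 0 <= w by lra.
have m0 : 0 < w ^+ 2 - B ^+ 2 by rewrite subr_gt0 ltr_sqr// nnegrE.
have v2 := rows_bounded_sumsq i B0 hB.
have [|y [yv yc]] := exists_row_combination (A := zero_row i A) m0 _ v2.
  move=> y; rewrite zero_row_mulmx mulrBl lerB// ?sigma_min_le//.
  apply: le_trans (dot_sqr_le _ _) _.
  by rewrite ler_wpM2r// sumsq_ge0.
(* Entry [i] of this vector vanishes with row [i] of [zero_row i A], whose transpose sends the
   vector to row [i] of [A] by [yv]. *)
exists (fun k => (zero_row i A *m y) k 0); split.
- by rewrite mxE big1// => j _; rewrite mxE eqxx mul0r.
- by rewrite mulrC.
- move=> j; have /matrixP/(_ j 0) := yv.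
  rewrite mxE [in RHS]mxE [in RHS]mxE => <-.
  by apply: eq_bigr => k _; rewrite mulrC; congr (_ * _); rewrite [RHS]mxE.
Qed.

End neighboring_matrices.

(** * Measurability of the projection *)

Section projection.
Context {R : realType} {r n d : nat}.
Local Notation T := (fspace R ('I_r * 'I_n)%type).

Definition mx_of (x : T) : 'M[R]_(r, n) := \matrix_(k, j) x (k, j).

(** The sets [S] with measurable preimage form a sigma-algebra; it contains the generators because
    each output entry is a linear combination of coordinates. *)
Lemma measurable_projection (A : 'M[R]_(n, d)) (S : set 'M[R]_(r, d)) :
  mx_measurable S -> measurable ([set x : T | S (mx_of x *m A)]).
Proof.
move: S; apply: smallest_sub => /=.
  split => /=.
  - exact: measurable0.
  - move=> B mB; have := measurableC mB; congr measurable.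
    by apply/seteqP; split => x /=; [move=> h; split|case].
  - by move=> B mB; exact: (bigcupT_measurable _ mB).
move=> _ [k [j [E [mE ->]]]] /=.
have mf : measurable_fun [set: T] (fun x : T => (mx_of x *m A) k j).
  rewrite (_ : (fun _ => _) = (fun x : T => \sum_l x (k, l) * A l j)); last first.
    by apply/funext => x; rewrite mxE; apply: eq_bigr => l _; rewrite mxE.
  apply: measurable_sum => l; apply: measurable_funM => //; exact: measurable_coord.
by have := mf measurableT _ mE; rewrite setTI.
Qed.

End projection.

(** * The published matrix as a product with a sheared Gaussian matrix *)

Section gaussian_projection.
Context dO (Omega : measurableType dO) {R : realType} (P : probability Omega R).
Context {r n d : nat} (G : 'I_r -> 'I_n -> Omega -> R).
Hypothesis hG : iid_std_gaussian_mx P G.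
Local Notation T := (fspace R ('I_r * 'I_n)%type).

Definition coords (w : Omega) : T := fun p => G p.1 p.2 w.

Lemma measurable_coords : measurable_fun [set: Omega] coords.
Proof. by apply: measurable_fspace => p; exact: hG.1. Qed.

Lemma coords_iid (E : 'I_r * 'I_n -> set R) : (forall p, measurable (E p)) ->
  P [set w | forall p, E p (coords w p)] = (\prod_p normal_prob 0 1 (E p))%E.
Proof.
move=> mE; have [_ [hN hP]] := hG.
transitivity (P (\bigcap_(k in [set: 'I_r * 'I_n]) (G k.1 k.2 @^-1` E (k.1, k.2)))).
  congr (P _); apply/seteqP; split => w h; first by move=> [k l] _; exact: (h (k, l)).
  by move=> [k l]; exact: (h (k, l) I).
rewrite (hP (fun k l => E (k, l))); last by move=> k l; exact: mE.
by apply: eq_bigr => -[k l] _ /=; exact: hN.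
Qed.

Variables (i : 'I_n) (A0 : 'M[R]_(n, d)) (S : set 'M[R]_(r, d)).
Hypotheses (A0i : forall j, A0 i j = 0) (mS : mx_measurable S).

Definition output_indic (x : T) : R := \1_[set x : T | S (mx_of x *m A0)] x.

Lemma output_indic01 x : output_indic x = 0 \/ output_indic x = 1.
Proof. by rewrite /output_indic indicE; case: (_ \in _); [right|left]. Qed.

Lemma measurable_output_indic : measurable_fun [set: T] output_indic.
Proof. by apply: measurable_indic; exact: measurable_projection. Qed.

(** Column [i] of the random matrix meets only row [i] of [A0], which is zero. *)
Lemma output_indic_off : off (fun p => p.2 == i) output_indic.
Proof.
move=> x x' h; rewrite /output_indic !indicE.
suff e : mx_of x *m A0 = mx_of x' *m A0.
  by congr (nat_of_bool _)%:R; apply/idP/idP; rewrite !inE /= e.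
apply/matrixP => k j; rewrite !mxE; apply: eq_bigr => l _; rewrite !mxE.
by have [->|li] := eqVneq l i; [rewrite A0i !mulr0|rewrite h].
Qed.

(** Writing row [i] of [A] through the rows of [A0] moves all dependence on [A] into the shear [z],
    so both neighbors can be compared with the same [A0]. *)
Lemma mean_output_shear (A : 'M[R]_(n, d)) (z : 'I_n -> R) :
  z i = 0 -> (forall k j, k != i -> A k j = A0 k j) ->
  (forall j, \sum_k z k * A0 k j = A i j) ->
  mean P coords (fun x => output_indic (fun p => x p + x (p.1, i) * z p.2)) =
  P [set w | rand_mx G w *m A \in S].
Proof.
move=> zi AA0 zA.
have mshear : measurable_fun [set: T] (fun x : T => (fun p => x p + x (p.1, i) * z p.2) : T).
  apply: measurable_fspace => p; apply: measurable_funD; first exact: measurable_coord.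
  by apply: measurable_funM => //; exact: measurable_coord.
have mxE_shear w : rand_mx G w *m A =
    mx_of (fun p => coords w p + coords w (p.1, i) * z p.2) *m A0.
  apply/matrixP => k j; rewrite !mxE.
  rewrite [RHS](eq_bigr (fun l => G k l w * A0 l j + G k i w * (z l * A0 l j))); last first.
    by move=> l _; rewrite !mxE /coords /=; ring.
  rewrite big_split/= -mulr_sumr zA (bigD1 i)//= [in RHS](bigD1 i)//= A0i mulr0 add0r.
  rewrite [RHS]addrC mxE; congr (_ + _).
  by apply: eq_bigr => l li; rewrite mxE AA0.
pose B : set Omega := [set w | S (mx_of (fun p => coords w p + coords w (p.1, i) * z p.2) *m A0)].
have mB : measurable B.
  have := measurableT_comp mshear measurable_coords measurableT (measurable_projection A0 mS).
  by rewrite setTI.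
transitivity (\int[P]_w (\1_B w)%:E)%E.
  by rewrite /mean; apply: eq_integral => w _; rewrite /output_indic !indicE.
rewrite integral_indic// setIT; congr (P _).
by apply/seteqP; split => w; rewrite /B /= inE mxE_shear.
Qed.

End gaussian_projection.

(** * Calibration of the parameters and chaining through the erased matrix *)

Theorem theoremB1 (R : realType) (eps delta B w : R) (r n d : nat)
    (heps : 0 < eps) (hdelta0 : 0 < delta) (hdelta1 : delta < (expR 1)^-1)
    (hB : 0 < B) (hr : (0 < r)%N) (hw0 : 0 < w)
    (hw : w ^+ 2 = B ^+ 2 * (1 + (1 + eps / ln (4 / delta)) / eps *
            (2 * Num.sqrt (2 * r%:R * ln (4 / delta)) + 2 * ln (4 / delta))))
    (hdr : (d < r)%N)
    (dO : measure_display) (Omega : measurableType dO) (P : probability Omega R)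
    (G : 'I_r -> 'I_n -> Omega -> R) (hG : iid_std_gaussian_mx P G) :
  gaussian_projection_dp P d G B w eps delta.
Proof.
move=> A A' hAB hAw hAB' hAw' [i [_ AA']] S mS.
set L := ln (4 / delta) in hw *.
set sigma := Num.sqrt (2 * r%:R * L) in hw *.
set T := (1 + eps / L) / eps * (2 * sigma + 2 * L) in hw *.
have delta1 : delta < 1.
  by apply: lt_trans hdelta1 _; rewrite invf_lt1 ?expR_gt0// expR_gt1.
have d4 : 1 < 4 / delta by rewrite ltr_pdivlMr// mul1r; lra.
have L0 : 0 < L by rewrite ln_gt0.
have rho0 : 0 < r%:R :> R by rewrite ltr0n.
have sigma0 : 0 < sigma by rewrite sqrtr_gt0 !mulr_gt0.
have sigmaE : sigma ^+ 2 = 2 * r%:R * L by rewrite sqr_sqrtr// !mulr_ge0// ltW.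
have T0 : 0 < T.
  apply: mulr_gt0; last by lra.
  by rewrite divr_gt0// addr_gt0// divr_gt0.
(* The prescribed [w] makes the bound [B ^+ 2 / (w ^+ 2 - B ^+ 2)] on [sqnorm z] equal to [T^-1]. *)
have wB : w ^+ 2 - B ^+ 2 = B ^+ 2 * T by rewrite hw; ring.
have Bw : B < w.
  by rewrite -ltr_sqr ?nnegrE ?ltW// -subr_gt0 wB mulr_gt0// exprn_gt0.
pose A0 := zero_row i A.
have A0' : zero_row i A' = A0.
  apply/matrixP => k j; rewrite !mxE; case: eqP => // /eqP ki.
  by have /matrixP/(_ 0 j) := AA' k ki; rewrite !mxE.
have A0i j : A0 i j = 0 by rewrite mxE eqxx.
have [z [zi zT zA]] := removed_row_combination i (ltW hB) Bw hAB hAw.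
have [z' [zi' zT' zA']] := removed_row_combination i (ltW hB) Bw hAB' hAw'.
rewrite -/A0 in zA; rewrite A0' in zA'.
have scale (a : R) : a * (w ^+ 2 - B ^+ 2) <= B ^+ 2 -> a * T <= 1.
  by rewrite wB mulrCA -[leRHS]mulr1 ler_pM2l// exprn_gt0.
have F01 := output_indic01 A0 S.
have mF := measurable_output_indic A0 mS.
have oF := output_indic_off S A0i.
have mX := measurable_coords hG.
have PX := coords_iid hG.
pose lam := 2 * (eps + L) / eps; pose lam' := 4 * (eps + L) / eps.
have lam0 : 0 <= lam by rewrite divr_ge0 ?mulr_ge0 ?addr_ge0// ltW.
have lam0' : 0 <= lam' by rewrite divr_ge0 ?mulr_ge0 ?addr_ge0// ltW.
have [lamz exz] := remove_row_exponent heps L0 rho0 sigma0 sigmaE (sqnorm_ge0 z) (scale _ zT).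
have exz' := add_row_exponent heps L0 rho0 sigma0 sigmaE (sqnorm_ge0 z') (scale _ zT').
have /= := mean_shear_le mX PX zi F01 mF oF (5 / 8 * eps) lam0 lamz.
have /= := mean_le_shear mX PX zi' F01 mF oF (3 / 8 * eps) lam0'.
rewrite (mean_output_shear hG A0i mS zi _ zA); last first.
  by move=> k j ki; rewrite mxE (negbTE ki).
rewrite (mean_output_shear hG A0i mS zi' _ zA'); last first.
  by move=> k j ki; rewrite -A0' mxE (negbTE ki).
have -> : mean P (coords G) (output_indic A0 S) = P [set w | rand_mx G w *m A0 \in S].
  (* The unsheared mean is the zero shear, with [A0] itself in the role of [A]. *)
  pose z0 (k : 'I_n) : R := 0.
  rewrite -(@mean_output_shear _ _ _ _ _ _ _ _ hG i A0 S A0i mS A0 z0)//.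
    by congr mean; apply/funext => x; congr output_indic; apply/funext => p; rewrite mulr0 addr0.
  by move=> j; rewrite A0i big1// => k _; rewrite mul0r.
move=> up down.
apply: (le_trans down).
(* Inserting [up] into [down] multiplies the error of [up] by [expR (5 / 8 * eps)]. *)
apply: le_trans (leeD2r _ (lee_wpmul2l _ up)) _; first by rewrite lee_fin expR_ge0.
rewrite muleDr ?fin_num_adde_defl//.
rewrite muleA -!EFinM -expRD -addeA.
have -> : 5 / 8 * eps + 3 / 8 * eps = eps by field.
apply: leeD2l; rewrite -EFinD lee_fin -expRD.
(* Each of the two errors is at most this quarter, even after that multiplication, so together they
   use at most half of [delta]. *)
have expL : expR (- L) = delta / 4.
  by rewrite expRN lnK ?posrE ?divr_gt0// invf_div.
have h1 : expR (5 / 8 * eps + - (lam' * (3 / 8 * eps)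
    - r%:R / 2 * lam' * ln (1 + sqnorm z')
    + r%:R / 2 * ln (1 + lam' * sqnorm z' / (1 + sqnorm z')))) <= expR (- L).
  rewrite ler_expR; move: exz'; rewrite /= -/lam'.
  by lra.
have h2 : expR (- (lam * (5 / 8 * eps) + r%:R / 2 * lam * ln (1 + sqnorm z)
    + r%:R / 2 * ln (1 - lam * sqnorm z))) <= expR (- L).
  by rewrite ler_expR lerN2.
by apply: le_trans (lerD h1 h2) _; rewrite expL; lra.
Qed.
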